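(* Let $X, Y$ be topological spaces, let $n \geq 1$ and let $f_1, \dots, f_n : X \to Y$ be globally multi-split continuous functions. Then every selection $g : X \to Y$ of the multifunction $\bigcup_{i=1}^n f_i : X \rightrightarrows Y$, $x \mapsto \{f_1(x), \dots, f_n(x)\}$, is globally multi-split continuous.
   Context: A neighborhood of a point $p$ (respectively of a subset $S$) in a topological space is a set $V$, not necessarily open, for which there is an open set $U$ with $p \in U \subseteq V$ (respectively $S \subseteq U \subseteq V$). Let $f : X \to Y$ be a function between topological spaces and $p \in X$. The function $f$ is multi-split continuous at $p$ if there exists a finite non-empty set $Z_p \subseteq Y$ such that: (a) for every $y \in Z_p$ and all neighborhoods $U \subseteq X$ of $p$ and $V \subseteq Y$ of $y$ one has $f(U) \cap V \neq \varnothing$; (b) for every neighborhood $V \subseteq Y$ of the set $Z_p$ there exists a neighborhood $U \subseteq X$ of $p$ with $f(U) \subseteq V$. The function $f$ is globally multi-split continuous if it is multi-split continuous at every $p \in X$. A multifunction $F : X \rightrightarrows Y$ is a map assigning to each $x \in X$ a subset $F(x) \subseteq Y$. A selection of $F$ is a function $g : X \to Y$ with $g(x) \in F(x)$ for all $x \in X$. *)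

(* Defs.v *)
From mathcomp Require Import all_boot.
From mathcomp Require Import boolp classical_sets functions cardinality topology.

Set Implicit Arguments.
Unset Strict Implicit.
Unset Printing Implicit Defensive.

Local Open Scope classical_set_scope.

(* Neighborhoods are not assumed open: [nbhs p V] holds iff p \in U `<=` V for
   some open U (lemma [nbhsE]), and likewise [set_nbhs S V] iff S `<=` U `<=` V
   for some open U (lemma [set_nbhsP]). *)
Definition multisplit_continuous_at (X Y : topologicalType) (f : X -> Y)
    (p : X) : Prop :=
  exists Z : set Y,
    [/\ finite_set Z,
        Z !=set0,
        forall y, Z y -> forall (U : set X) (V : set Y),
          nbhs p U -> nbhs y V -> (f @` U) `&` V !=set0
      & forall V : set Y, set_nbhs Z V ->
          exists U : set X, nbhs p U /\ f @` U `<=` V].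

Definition multisplit_continuous (X Y : topologicalType) (f : X -> Y) : Prop :=
  forall p : X, multisplit_continuous_at f p.

Definition multifunction (X Y : Type) : Type := X -> set Y.

Definition is_selection (X Y : Type) (F : multifunction X Y) (g : X -> Y) :
    Prop :=
  forall x : X, F x (g x).

Definition union_multifunction (X Y : Type) (n : nat) (f : 'I_n -> X -> Y) :
    multifunction X Y :=
  fun x => [set f i x | i in [set: 'I_n]].

(* Main.v *)
Require Import Defs.
From mathcomp Require Import all_boot.
From mathcomp Require Import boolp classical_sets functions cardinality topology.

(** Clause (a) in the definition of multi-split continuity says that every point
    of [Z] is a cluster point of the image filter [g @ p], and clause (b) says
    that this filter refines the neighborhood filter of [Z]. The point of the
    proof is that (a) can be enforced afterwards: if a finite set [W] satisfies
    (b), then so does the set of those points of [W] at which [g @ p] clusters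
    ([set_nbhs_cluster_sub]). Indeed each of the other points has a neighborhood
    avoided by [g] near [p], and there are only finitely many of them. The
    pruned set is nonempty because a proper filter does not refine the
    neighborhood filter of the empty set. Hence multi-split continuity at [p]
    amounts to the existence of a finite set satisfying (b)
    ([multisplit_continuous_atP]).

    For a selection [g] of [f_1, ..., f_n], let [W] be the union of the finite
    sets that witness the continuity of the [f_i] at [p]. A neighborhood of [W]
    is a neighborhood of each of these sets, so near [p] it contains the values
    of all the [f_i] simultaneously, hence those of [g]. *)

Local Open Scope classical_set_scope.

(** Every point [y] of [W] gets a neighborhood [N y] such that values in [N y]
    eventually lie in [V]: [V] itself serves if [y] is a cluster point, and
    otherwise a neighborhood disjoint from some member of [G]. Since [W] is
    finite, eventually this holds for all [y] at once, while the union of the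
    [N y] is a neighborhood of [W] and so also belongs to [G]. *)
Lemma set_nbhs_cluster_sub (Y : topologicalType) (G : set_system Y)
    (W : set Y) : Filter G -> finite_set W -> set_nbhs W `<=` G ->
  set_nbhs (W `&` cluster G) `<=` G.
Proof.
move=> FG finW WG V ZV.
have /choice[N NP] : forall y, exists N : set Y,
    W y -> nbhs y N /\ G (~` N `|` V).
  move=> y; case: (pselect (cluster G y)) => [cy|ncy].
    by exists V => Wy; split; [exact: ZV | rewrite setUC setUv; exact: filterT].
  have [A [B [GA yB AB0]]] :
      exists A B, [/\ G A, nbhs y B & ~ (A `&` B !=set0)].
    apply: contra_notP ncy => noAB A B GA yB.
    by apply: contra_notP noAB => ?; exists A, B.
  exists B => _; split=> //.
  by apply: filterS GA => z Az; left=> Bz; apply: AB0; exists z.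
have GN : G (\bigcup_(y in W) N y).
  apply: WG => y Wy; have [yN _] := NP y Wy.
  by apply: filterS yN => z Nz; exists y.
have GNV : G (\bigcap_(y in W) (~` N y `|` V)).
  have [D WD] := finite_fsetP.1 finW; rewrite WD.
  apply: filter_bigI => y yD.
  by have [|_ //] := NP y; rewrite WD.
apply: filterS (filterI GN GNV) => z [[y Wy Nyz] NVz].
by have [/(_ Nyz)|] := NVz y Wy.
Qed.

(** A finite set need only satisfy the upper bound (b): its points that are not
    cluster points of [g @ p] can be discarded. *)
Lemma multisplit_continuous_atP (X Y : topologicalType) (g : X -> Y) (p : X) :
  multisplit_continuous_at g p <->
  exists2 W : set Y, finite_set W & set_nbhs W `<=` g @ p.
Proof.
split=> [[Z [finZ _ _ Zb]]|[W finW Wg]].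
  exists Z => // V /Zb[U [pU UV]].
  by apply: filterS pU => x Ux; apply: UV; exists x.
have Zg := set_nbhs_cluster_sub _ _ _ _ finW Wg.
exists (W `&` cluster (g @ p)); split.
- exact: finite_setIl.
- apply/set0P/eqP => Z0.
  have : (g @ p) set0 by apply: Zg; rewrite Z0 => y.
  exact: filter_not_empty.
- move=> y [_ cy] U V pU yV; apply: cy => //.
  by apply: filterS pU => x Ux; exists x.
- move=> V /Zg pV; exists (g @^-1` V); split=> //.
  by move=> _ [x Vx <-].
Qed.

Theorem corollary5p11 (X Y : topologicalType) (n : nat) (n_ge1 : 1 <= n)
    (f : 'I_n -> X -> Y) (f_msc : forall i : 'I_n, multisplit_continuous (f i))
    (g : X -> Y) (g_sel : is_selection (union_multifunction f) g) :
  multisplit_continuous g.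
Proof.
move=> p; apply/multisplit_continuous_atP.
have /choice[Z ZP] : forall i, exists Z : set Y,
    finite_set Z /\ set_nbhs Z `<=` f i @ p.
  by move=> i; have /multisplit_continuous_atP[Z] := f_msc i p; exists Z.
exists (\bigcup_(i in [set: 'I_n]) Z i).
  by apply: bigcup_finite => // i _; have [] := ZP i.
move=> V WV.
have near_all : \forall x \near p, forall i, V (f i x).
  apply: filter_forall => i; have [_] := ZP i; apply=> y Ziy.
  by apply: WV; exists i.
apply: filterS near_all => x Vfx.
by have [i _ /= <-] := g_sel x.
Qed.
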